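(* Let $a_0$ be the unique solution of $27a^2-54a^3=-1$ in the interval $(1/2,2/3)$. For all $a\in(0,1/3)\cup(1/3,1/2)\cup(1/2,a_0)$ and all $x\in[0,1]$, the second derivative $F_a''(x)$ does not exist.
   Context: For $a\in(0,1)$ the function $F_a:[0,1]\to[0,1]$ is defined as follows. Define continuous functions $f_i:[0,1]\to[0,1]$, $i\ge 0$, inductively: $f_0(x)=x$ for all $x\in[0,1]$; each $f_i$ is continuous on $[0,1]$ and affine on each subinterval $[k/3^i,(k+1)/3^i]$, $k\in\{0,1,\ldots,3^i-1\}$; and for all $i\ge 0$ and $k\in\{0,1,\ldots,3^i-1\}$, $$f_{i+1}\left(\frac{k}{3^i}\right)=f_i\left(\frac{k}{3^i}\right),\qquad f_{i+1}\left(\frac{3k+1}{3^{i+1}}\right)=f_i\left(\frac{k}{3^i}\right)+a\left[f_i\left(\frac{k+1}{3^i}\right)-f_i\left(\frac{k}{3^i}\right)\right],$$ $$f_{i+1}\left(\frac{3k+2}{3^{i+1}}\right)=f_i\left(\frac{k}{3^i}\right)+(1-a)\left[f_i\left(\frac{k+1}{3^i}\right)-f_i\left(\frac{k}{3^i}\right)\right],\qquad f_{i+1}\left(\frac{k+1}{3^i}\right)=f_i\left(\frac{k+1}{3^i}\right).$$ Then $F_a=\lim_{i\to\infty}f_i$. The derivative $F_a'(x)$ is said to exist when the difference quotient of $F_a$ at $x$ has a finite limit (one-sided at the endpoints $0$ and $1$). The second derivative is understood in the usual sense: $F_a''(x)$ exists if $F_a'$ exists at every point of some neighborhood of $x$ in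 $[0,1]$ and the function $F_a'$ is differentiable at $x$. *)

(* Defs.v *)
From Stdlib Require Import Reals Lra Lia ZArith Arith.
From Coquelicot Require Import Coquelicot.
Open Scope R_scope.

(* [okamoto_node a i k] is f_i(k/3^i); the values for k > 3^i do not
   affect f_i on [0,1]. Division by 3 locates the triadic cell of the previous level:
   k = 3q + r with r = 0, 1, 2. *)
Fixpoint okamoto_node (a : R) (i k : nat) : R :=
  match i with
  | O => INR k
  | S j =>
      let q := (k / 3)%nat in
      let d := okamoto_node a j (S q) - okamoto_node a j q in
      match (k mod 3)%nat with
      | O => okamoto_node a j q
      | 1%nat => okamoto_node a j q + a * d
      | _ => okamoto_node a j q + (1 - a) * d
      end
  end.

(* f_i, the piecewise affine interpolation of the values at the nodes k/3^i;
   here k = floor (3^i x). Lemmas [okamoto_approx_0], [okamoto_approx_affine],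
   [okamoto_approx_rec], [okamoto_approx_continuous] check the properties that
   characterize f_i on [0,1]. *)
Definition okamoto_approx (a : R) (i : nat) (x : R) : R :=
  let k := Z.to_nat (Int_part (3 ^ i * x)) in
  okamoto_node a i k
  + (3 ^ i * x - INR k) * (okamoto_node a i (S k) - okamoto_node a i k).

(* F_a. [Lim_seq] is a total operator; the sequence does converge on [0,1] for
   0 < a < 1, see [okamoto_cv]. *)
Definition okamoto (a x : R) : R :=
  real (Lim_seq (fun i => okamoto_approx a i x)).

Definition unit_interval (x : R) : Prop := 0 <= x <= 1.

(* The standard library's [D_in f g D x] says that the difference quotient of
   f at x, taken over points of D other than x, tends to the real number g x;
   for D = [0,1] it is the two-sided derivative inside and the one-sided one
   at the endpoints. *)
Definition ex_second_derivative (f : R -> R) (x : R) : Prop :=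
  exists f' : R -> R,
    (exists delta : R, 0 < delta /\
       forall y, unit_interval y -> Rabs (y - x) < delta ->
         D_in f f' unit_interval y)
    /\ exists f'' : R -> R, D_in f' f'' unit_interval x.

Lemma okamoto_approx_cell (a : R) (i k : nat) (x : R) :
  INR k <= 3 ^ i * x <= INR (S k) ->
  okamoto_approx a i x =
  okamoto_node a i k
  + (3 ^ i * x - INR k) * (okamoto_node a i (S k) - okamoto_node a i k).
Proof.
  intros [H1 H2]; unfold okamoto_approx; rewrite S_INR in H2.
  destruct (Req_dec (3 ^ i * x) (INR (S k))) as [E|E].
  - rewrite E, Int_part_INR, Nat2Z.id, S_INR; ring.
  - rewrite S_INR in E.
    replace (Int_part (3 ^ i * x)) with (Z.of_nat k).
    + rewrite Nat2Z.id; ring.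
    + apply Int_part_spec; rewrite <- INR_IZR_INZ; lra.
Qed.

Lemma okamoto_approx_node (a : R) (i k : nat) :
  okamoto_approx a i (INR k / 3 ^ i) = okamoto_node a i k.
Proof.
  assert (H3 : 3 ^ i <> 0) by (apply pow_nonzero; lra).
  assert (E : 3 ^ i * (INR k / 3 ^ i) = INR k) by (field; exact H3).
  rewrite (okamoto_approx_cell a i k); rewrite E; [ring|].
  rewrite S_INR; lra.
Qed.

Lemma okamoto_approx_0 (a x : R) : 0 <= x -> okamoto_approx a 0 x = x.
Proof.
  intros Hx; unfold okamoto_approx; cbn [okamoto_node]; rewrite S_INR.
  simpl (3 ^ 0); ring.
Qed.

Lemma okamoto_approx_affine (a : R) (i k : nat) :
  exists b c : R, forall x, INR k / 3 ^ i <= x <= INR (S k) / 3 ^ i ->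
    okamoto_approx a i x = b * x + c.
Proof.
  assert (H3 : 0 < 3 ^ i) by (apply pow_lt; lra).
  set (d := okamoto_node a i (S k) - okamoto_node a i k).
  exists (3 ^ i * d), (okamoto_node a i k - INR k * d); intros x [H1 H2].
  rewrite (okamoto_approx_cell a i k).
  - fold d; ring.
  - split.
    + apply Rle_div_l in H1; lra.
    + apply Rle_div_r in H2; lra.
Qed.

Lemma okamoto_approx_rec (a : R) (i k : nat) :
  let f := okamoto_approx a in
  let u := INR k / 3 ^ i in
  let v := INR (S k) / 3 ^ i in
  f (S i) u = f i u
  /\ f (S i) (INR (3 * k + 1) / 3 ^ S i) = f i u + a * (f i v - f i u)
  /\ f (S i) (INR (3 * k + 2) / 3 ^ S i) = f i u + (1 - a) * (f i v - f i u)
  /\ f (S i) v = f i v.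
Proof.
  intros f u v; unfold f, u, v.
  assert (H3 : 3 ^ i <> 0) by (apply pow_nonzero; lra).
  assert (T : forall m, INR m / 3 ^ i = INR (3 * m) / 3 ^ S i).
  { intros m; rewrite mult_INR; simpl (INR 3); simpl (3 ^ S i); field; exact H3. }
  assert (N : forall m,
    okamoto_approx a (S i) (INR m / 3 ^ i) = okamoto_node a i m).
  { intros m; rewrite T, okamoto_approx_node; cbn [okamoto_node].
    replace (3 * m)%nat with (m * 3)%nat by lia.
    rewrite Nat.Div0.mod_mul, Nat.div_mul by lia; reflexivity. }
  rewrite !N, !okamoto_approx_node; cbn [okamoto_node].
  assert (E1 : ((3 * k + 1) / 3)%nat = k)
    by (symmetry; apply (Nat.div_unique _ _ _ 1); lia).
  assert (E2 : ((3 * k + 2) / 3)%nat = k)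
    by (symmetry; apply (Nat.div_unique _ _ _ 2); lia).
  assert (M1 : ((3 * k + 1) mod 3)%nat = 1%nat)
    by (symmetry; apply (Nat.mod_unique _ _ k); lia).
  assert (M2 : ((3 * k + 2) mod 3)%nat = 2%nat)
    by (symmetry; apply (Nat.mod_unique _ _ k); lia).
  rewrite E1, E2, M1, M2; repeat split.
Qed.

Lemma nat_cell (t : R) : 0 <= t ->
  exists k : nat, INR k <= t < INR (S k).
Proof.
  intros Ht; destruct (base_Int_part t) as [H1 H2].
  assert (0 <= Int_part t)%Z.
  { apply Z.lt_succ_r, lt_IZR; rewrite succ_IZR; lra. }
  exists (Z.to_nat (Int_part t)).
  rewrite S_INR, INR_IZR_INZ, Z2Nat.id by assumption; lra.
Qed.

Definition okamoto_ratio (a : R) : R := Rmax a (Rabs (1 - 2 * a)).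

Lemma okamoto_node_incr (a : R) (i k : nat) : 0 < a < 1 ->
  Rabs (okamoto_node a i (S k) - okamoto_node a i k) <= okamoto_ratio a ^ i.
Proof.
  intros Ha; revert k; induction i as [|i IH]; intros k.
  - cbn [okamoto_node pow]; rewrite S_INR.
    replace (INR k + 1 - INR k) with 1 by ring; rewrite Rabs_R1; lra.
  - assert (B : exists b, Rabs b <= okamoto_ratio a /\
      okamoto_node a (S i) (S k) - okamoto_node a (S i) k =
      b * (okamoto_node a i (S (k / 3)) - okamoto_node a i (k / 3))).
    { assert (R1 : Rabs a <= okamoto_ratio a).
      { rewrite Rabs_pos_eq by lra; unfold okamoto_ratio.
        apply Rmax_l. }
      assert (R2 : Rabs (1 - 2 * a) <= okamoto_ratio a) by apply Rmax_r.
      pose proof (Nat.div_mod_eq k 3) as D.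
      pose proof (Nat.mod_upper_bound k 3 ltac:(lia)) as L.
      cbn [okamoto_node].
      destruct (k mod 3)%nat as [|[|[|r]]] eqn:E; [| | |lia].
      - rewrite <- (Nat.div_unique (S k) 3 (k / 3) 1) by lia.
        rewrite <- (Nat.mod_unique (S k) 3 (k / 3) 1) by lia.
        exists a; split; [exact R1|ring].
      - rewrite <- (Nat.div_unique (S k) 3 (k / 3) 2) by lia.
        rewrite <- (Nat.mod_unique (S k) 3 (k / 3) 2) by lia.
        exists (1 - 2 * a); split; [exact R2|ring].
      - rewrite <- (Nat.div_unique (S k) 3 (S (k / 3)) 0) by lia.
        rewrite <- (Nat.mod_unique (S k) 3 (S (k / 3)) 0) by lia.
        exists a; split; [exact R1|ring]. }
    destruct B as (b & Hb & ->); rewrite Rabs_mult; simpl.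
    apply Rmult_le_compat; auto using Rabs_pos.
Qed.

Lemma okamoto_ratio_lt1 (a : R) : 0 < a < 1 -> 0 < okamoto_ratio a < 1.
Proof.
  intros Ha; unfold okamoto_ratio; split.
  - eapply Rlt_le_trans; [|apply Rmax_l]; lra.
  - repeat apply Rmax_lub_lt; try lra; apply Rabs_def1; lra.
Qed.

Lemma okamoto_approx_step (a : R) (i : nat) (x : R) : 0 < a < 1 -> 0 <= x ->
  Rabs (okamoto_approx a (S i) x - okamoto_approx a i x)
  <= 3 * okamoto_ratio a ^ i.
Proof.
  intros Ha Hx.
  assert (H3 : 0 < 3 ^ i) by (apply pow_lt; lra).
  destruct (nat_cell (3 ^ S i * x)) as [k [K1 K2]].
  { apply Rmult_le_pos; [apply pow_le; lra|exact Hx]. }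
  pose proof (Nat.div_mod_eq k 3) as D.
  pose proof (Nat.mod_upper_bound k 3 ltac:(lia)) as L.
  set (q := (k / 3)%nat) in *.
  set (r := (k mod 3)%nat) in *.
  assert (Kr : INR k = 3 * INR q + INR r).
  { rewrite D, plus_INR, mult_INR; simpl (INR 3); ring. }
  assert (Lr : 0 <= INR r <= 2).
  { split; [apply pos_INR|]. change 2 with (INR 2); apply le_INR; lia. }
  rewrite S_INR in K2; simpl pow in K1, K2.
  rewrite (okamoto_approx_cell a i q) by (rewrite S_INR; lra).
  rewrite (okamoto_approx_cell a (S i) k) by (rewrite S_INR; simpl pow; lra).
  set (s := 3 ^ i * x - INR q).
  set (t := 3 ^ S i * x - INR k).
  pose proof (okamoto_node_incr a i q Ha) as I1.
  pose proof (okamoto_node_incr a (S i) k Ha) as I2.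
  destruct (okamoto_ratio_lt1 a Ha) as [C1 C2].
  assert (C3 : 0 < okamoto_ratio a ^ i) by (apply pow_lt; lra).
  assert (Hs : Rabs s <= 1) by (apply Rabs_le; unfold s; lra).
  assert (Ht : Rabs t <= 1) by (apply Rabs_le; unfold t; simpl pow; lra).
  assert (I2' : Rabs (okamoto_node a (S i) (S k) - okamoto_node a (S i) k)
                <= okamoto_ratio a ^ i).
  { eapply Rle_trans; [exact I2|]; simpl; nra. }
  set (d := okamoto_node a i (S q) - okamoto_node a i q) in *.
  assert (B : exists b, Rabs b <= 1 /\
    okamoto_node a (S i) k = okamoto_node a i q + b * d).
  { cbn [okamoto_node]; fold q; fold r; fold d.
    destruct r as [|[|r']].
    - exists 0; rewrite Rabs_R0; split; [lra|ring].
    - exists a; split; [apply Rabs_le; lra|ring].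
    - exists (1 - a); split; [apply Rabs_le; lra|ring]. }
  destruct B as (b & Hb & B); set (d' := _ - okamoto_node a (S i) k) in *.
  rewrite B.
  replace (okamoto_node a i q + b * d + t * d' - (okamoto_node a i q + s * d))
    with (b * d + t * d' + - (s * d)) by ring.
  assert (P : forall u v c, Rabs u <= 1 -> Rabs v <= c -> Rabs (u * v) <= c).
  { intros u v c Hu Hv; rewrite Rabs_mult.
    pose proof (Rabs_pos u); pose proof (Rabs_pos v); nra. }
  pose proof (P b d _ Hb I1); pose proof (P t d' _ Ht I2').
  pose proof (P s d _ Hs I1).
  eapply Rle_trans; [apply Rabs_triang|]; rewrite Rabs_Ropp.
  pose proof (Rabs_triang (b * d) (t * d')); lra.
Qed.

Lemma okamoto_cv (a x : R) : 0 < a < 1 -> 0 <= x ->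
  is_lim_seq (fun i => okamoto_approx a i x) (okamoto a x).
Proof.
  intros Ha Hx; set (u := fun i => okamoto_approx a i x).
  destruct (okamoto_ratio_lt1 a Ha) as [C1 C2].
  assert (S1 : ex_series (fun i => u (S i) - u i)).
  { apply (ex_series_le (K := R_AbsRing) (V := R_CompleteNormedModule) _
             (fun i => 3 * okamoto_ratio a ^ i)).
    - intros i; exact (okamoto_approx_step a i x Ha Hx).
    - apply (ex_series_scal_l 3 (fun i => okamoto_ratio a ^ i)), ex_series_geom.
      rewrite Rabs_pos_eq; lra. }
  destruct S1 as [l Hl].
  assert (T : forall n, sum_n (fun i => u (S i) - u i) n = u (S n) - u O).
  { induction n as [|n IH]; [apply sum_O|].
    rewrite sum_Sn, IH; unfold plus; simpl; ring. }
  assert (L : is_lim_seq u (l + u O)).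
  { apply is_lim_seq_incr_1.
    apply (is_lim_seq_ext (fun n => sum_n (fun i => u (S i) - u i) n + u O)).
    - intros n; rewrite T; ring.
    - apply (is_lim_seq_plus' _ _ l (u O)); [exact Hl|apply is_lim_seq_const]. }
  unfold okamoto; fold u; rewrite (is_lim_seq_unique _ _ L); exact L.
Qed.

Lemma okamoto_approx_lip_cell (a : R) (i k : nat) (x y : R) : 0 < a < 1 ->
  INR k <= 3 ^ i * x <= INR (S k) -> INR k <= 3 ^ i * y <= INR (S k) ->
  Rabs (okamoto_approx a i y - okamoto_approx a i x) <= 3 ^ i * Rabs (y - x).
Proof.
  intros Ha Hx Hy.
  rewrite (okamoto_approx_cell a i k x Hx), (okamoto_approx_cell a i k y Hy).
  pose proof (okamoto_node_incr a i k Ha) as I1.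
  destruct (okamoto_ratio_lt1 a Ha) as [C1 C2].
  assert (C3 : okamoto_ratio a ^ i <= 1).
  { rewrite <- (pow1 i); apply pow_incr; lra. }
  set (d := okamoto_node a i (S k) - okamoto_node a i k) in *.
  replace (_ - _) with (3 ^ i * (y - x) * d) by ring.
  assert (H3 : 0 < 3 ^ i) by (apply pow_lt; lra).
  rewrite !Rabs_mult, (Rabs_pos_eq (3 ^ i)) by lra.
  assert (0 <= 3 ^ i * Rabs (y - x))
    by (apply Rmult_le_pos; [lra|apply Rabs_pos]).
  nra.
Qed.

Lemma okamoto_approx_lip (a : R) (i : nat) (x y : R) : 0 < a < 1 ->
  0 <= x <= y -> 3 ^ i * (y - x) < 1 ->
  Rabs (okamoto_approx a i y - okamoto_approx a i x) <= 3 ^ i * (y - x).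
Proof.
  intros Ha Hx Hxy.
  assert (H3 : 0 < 3 ^ i) by (apply pow_lt; lra).
  destruct (nat_cell (3 ^ i * x)) as [k [K1 K2]]; [nra|].
  destruct (Rle_lt_dec (3 ^ i * y) (INR (S k))) as [C|C].
  - rewrite <- (Rabs_pos_eq (y - x)) by lra.
    apply (okamoto_approx_lip_cell a i k); nra.
  - set (z := INR (S k) / 3 ^ i).
    assert (Z : 3 ^ i * z = INR (S k)) by (unfold z; field; lra).
    assert (xz : x <= z) by nra.
    assert (zy : z <= y) by nra.
    assert (L1 := okamoto_approx_lip_cell a i k x z Ha).
    assert (L2 := okamoto_approx_lip_cell a i (S k) z y Ha).
    rewrite Z in L1, L2; rewrite (S_INR (S k)) in L2; clearbody z.
    pose proof (S_INR k).
    specialize (L1 ltac:(lra) ltac:(lra)); specialize (L2 ltac:(lra) ltac:(lra)).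
    rewrite (Rabs_pos_eq (z - x)) in L1 by lra.
    rewrite (Rabs_pos_eq (y - z)) in L2 by lra.
    replace (okamoto_approx a i y - okamoto_approx a i x) with
      ((okamoto_approx a i y - okamoto_approx a i z)
       + (okamoto_approx a i z - okamoto_approx a i x)) by ring.
    eapply Rle_trans; [apply Rabs_triang|]; lra.
Qed.

Lemma okamoto_approx_continuous (a : R) (i : nat) (x : R) : 0 < a < 1 ->
  unit_interval x ->
  limit1_in (okamoto_approx a i) unit_interval (okamoto_approx a i x) x.
Proof.
  intros Ha Hx eps Heps.
  assert (H3 : 0 < 3 ^ i) by (apply pow_lt; lra).
  exists (Rmin 1 eps / 3 ^ i).
  assert (M : 0 < Rmin 1 eps) by (apply Rmin_glb_lt; lra).
  split; [apply Rdiv_lt_0_compat; assumption|].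
  simpl; unfold Rdist, unit_interval in *; intros y [Hy D].
  apply Rlt_div_r in D; [|exact H3].
  pose proof (Rmin_l 1 eps); pose proof (Rmin_r 1 eps).
  destruct (Rle_lt_dec x y) as [C|C].
  - rewrite Rabs_pos_eq in D by lra.
    eapply Rle_lt_trans; [apply okamoto_approx_lip|]; lra.
  - rewrite Rabs_minus_sym in D |- *; rewrite Rabs_pos_eq in D by lra.
    eapply Rle_lt_trans; [apply okamoto_approx_lip|]; lra.
Qed.

(* Main.v *)
Require Import Defs.
From Stdlib Require Import Reals Lra Lia Arith.
From Coquelicot Require Import Coquelicot.
Open Scope R_scope.

(** No second derivative exists because even the first derivative fails to
    exist on a dense set.  Passing from a triadic cell to its three children
    multiplies the increment of [F_a] by [a], [1 - 2 * a], [a] respectively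
    ([okamoto_node_child]), hence the slope by [3 * a], [3 * (1 - 2 * a)],
    [3 * a].  These three numbers have mean [1], so when [a] is not [1/3] one of
    them exceeds [1].  Start in an arbitrary cell, whose increment is nonzero
    when [a] is not [1/2], and keep choosing that child.  The slopes of the
    nested cells blow up, while differentiability at their common point would
    keep them bounded ([D_in_chord_bound]).  The common point is the left
    endpoint of the starting cell when [a > 1/3] and its midpoint when
    [a < 1/3] ([okamoto_not_derivable]).  Since every neighborhood of [x]
    contains a cell ([small_cell]), [F_a'] is undefined somewhere in each of
    them. *)

(** * Values of the Okamoto function at triadic points *)

Definition child_ratio (a : R) (r : nat) : R :=
  match r with 1%nat => 1 - 2 * a | _ => a end.

Definition cell_increment (a : R) (i k : nat) : R :=
  okamoto_node a i (S k) - okamoto_node a i k.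

Lemma okamoto_node_triple (a : R) (i k : nat) :
  okamoto_node a (S i) (3 * k) = okamoto_node a i k.
Proof.
  cbn [okamoto_node]; rewrite (Nat.mul_comm 3 k).
  rewrite Nat.Div0.mod_mul, Nat.div_mul by lia; reflexivity.
Qed.

Lemma okamoto_node_child (a : R) (i k r : nat) : (r < 3)%nat ->
  cell_increment a (S i) (3 * k + r) = child_ratio a r * cell_increment a i k.
Proof.
  intros Hr; unfold cell_increment.
  assert (N1 : okamoto_node a (S i) (3 * k + 1) =
    okamoto_node a i k + a * (okamoto_node a i (S k) - okamoto_node a i k)).
  { cbn [okamoto_node].
    rewrite <- (Nat.div_unique (3 * k + 1) 3 k 1) by lia.
    rewrite <- (Nat.mod_unique (3 * k + 1) 3 k 1) by lia; reflexivity. }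
  assert (N2 : okamoto_node a (S i) (3 * k + 2) = okamoto_node a i k
    + (1 - a) * (okamoto_node a i (S k) - okamoto_node a i k)).
  { cbn [okamoto_node].
    rewrite <- (Nat.div_unique (3 * k + 2) 3 k 2) by lia.
    rewrite <- (Nat.mod_unique (3 * k + 2) 3 k 2) by lia; reflexivity. }
  rewrite <- Nat.add_succ_r.
  destruct r as [|[|[|r]]]; [| | |lia]; unfold child_ratio.
  - rewrite N1, Nat.add_0_r, okamoto_node_triple; ring.
  - rewrite N1, N2; ring.
  - rewrite N2; replace (3 * k + 3)%nat with (3 * S k)%nat by lia.
    rewrite okamoto_node_triple; ring.
Qed.

Lemma cell_increment_neq_0 (a : R) (i k : nat) :
  a <> 0 -> a <> 1 / 2 -> cell_increment a i k <> 0.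
Proof.
  intros H0 H2; revert k; induction i as [|i IH]; intros k.
  - unfold cell_increment; cbn [okamoto_node]; rewrite S_INR; lra.
  - rewrite (Nat.div_mod_eq k 3), okamoto_node_child
      by (apply Nat.mod_upper_bound; lia).
    apply Rmult_integral_contrapositive; split; [|apply IH].
    destruct (k mod 3)%nat as [|[|]]; simpl; lra.
Qed.

(** The approximations settle at [k / 3 ^ i] from level [i] on, because a
    node of one level stays a node, with the same value, at the next. *)
Lemma okamoto_at_node (a : R) (i k : nat) :
  okamoto a (INR k / 3 ^ i) = okamoto_node a i k.
Proof.
  assert (E : forall n,
    okamoto_approx a (n + i) (INR k / 3 ^ i) = okamoto_node a i k).
  { intros n.
    assert (N : okamoto_node a (n + i) (3 ^ n * k) = okamoto_node a i k).
    { induction n as [|n IH].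
      - simpl; rewrite Nat.add_0_r; reflexivity.
      - rewrite <- IH, Nat.pow_succ_r', <- Nat.mul_assoc.
        exact (okamoto_node_triple a (n + i) (3 ^ n * k)). }
    rewrite <- N, <- okamoto_approx_node; f_equal.
    rewrite mult_INR, pow_INR, pow_add; simpl (INR 3).
    replace (1 + 1 + 1) with 3 by ring.
    field; split; apply pow_nonzero; lra. }
  unfold okamoto; rewrite <- (Lim_seq_incr_n _ i).
  rewrite (Lim_seq_ext _ (fun _ => okamoto_node a i k)) by exact E.
  rewrite Lim_seq_const; reflexivity.
Qed.

(** * Differentiability bounds the chords around a point *)

(** Chords are taken between points on both sides of [y], which may coincide
    with [y]: the deviation from the tangent at [y] adds up over the two
    pieces. *)
Lemma D_in_chord_bound (f f' : R -> R) (D : R -> Prop) (y : R) :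
  D_in f f' D y ->
  exists delta C : R, 0 < delta /\
    forall u v, D u -> D v -> u <= y <= v ->
      y - u < delta -> v - y < delta -> Rabs (f v - f u) <= C * (v - u).
Proof.
  intros H; destruct (H 1 Rlt_0_1) as (delta & Hd & B).
  simpl in B; unfold Rdist, D_x in B.
  set (C := Rabs (f' y) + 1).
  assert (L : forall z, D z -> Rabs (z - y) < delta ->
    Rabs (f z - f y) <= C * Rabs (z - y)).
  { intros z Dz Hz; destruct (Req_dec y z) as [<-|N].
    - rewrite !Rminus_diag, Rabs_R0; lra.
    - specialize (B z (conj (conj Dz N) Hz)).
      replace (f z - f y) with ((f z - f y) / (z - y) * (z - y))
        by (field; lra).
      rewrite Rabs_mult; apply Rmult_le_compat_r; [apply Rabs_pos|].
      pose proof (Rabs_triang_inv ((f z - f y) / (z - y)) (f' y)).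
      unfold C; lra. }
  exists delta, C; split; [exact Hd|]; intros u v Du Dv Huv Hu Hv.
  pose proof (L u Du) as Lu; pose proof (L v Dv) as Lv.
  rewrite (Rabs_minus_sym u y), (Rabs_minus_sym (f u)), (Rabs_pos_eq (y - u)) in Lu
    by lra.
  rewrite (Rabs_pos_eq (v - y)) in Lv by lra.
  replace (f v - f u) with ((f v - f y) + (f y - f u)) by ring.
  eapply Rle_trans; [apply Rabs_triang|].
  specialize (Lu Hu); specialize (Lv Hv); lra.
Qed.

(** * Points where the Okamoto function is not differentiable *)

(** Always choosing child [r] gives nested cells shrinking to the point at
    the fraction [r / 2] of the starting cell, since [r / 2] is the fixed point
    of [t |-> (r + t) / 3].  This position is the same in each of them, which
    is what the induction uses. *)
Lemma nested_cells (a : R) (n k r m : nat) : (r < 3)%nat -> (k < 3 ^ n)%nat ->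
  exists j : nat, (j < 3 ^ (n + m))%nat /\
    (INR j + INR r / 2) / 3 ^ (n + m) = (INR k + INR r / 2) / 3 ^ n /\
    cell_increment a (n + m) j = child_ratio a r ^ m * cell_increment a n k.
Proof.
  intros Hr Hk; induction m as [|m (j & J1 & J2 & J3)].
  - exists k; rewrite Nat.add_0_r; repeat split; [exact Hk|simpl; ring].
  - exists (3 * j + r)%nat; rewrite Nat.add_succ_r; split; [|split].
    + rewrite Nat.pow_succ_r'; lia.
    + rewrite <- J2, plus_INR, mult_INR; simpl (INR 3); simpl pow.
      field; apply pow_nonzero; lra.
    + rewrite okamoto_node_child, J3 by exact Hr; simpl; ring.
Qed.

Lemma okamoto_not_derivable (a : R) (f' : R -> R) (n k r : nat) :
  (r < 3)%nat -> (k < 3 ^ n)%nat ->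
  cell_increment a n k <> 0 -> 1 < Rabs (3 * child_ratio a r) ->
  ~ D_in (okamoto a) f' unit_interval ((INR k + INR r / 2) / 3 ^ n).
Proof.
  intros Hr Hk Hd Hb H.
  set (y := (INR k + INR r / 2) / 3 ^ n) in *.
  destruct (D_in_chord_bound _ _ _ _ H) as (delta & C & Hdelta & B).
  set (d := cell_increment a n k) in *.
  assert (P : forall i, 0 < 3 ^ i) by (intros i; apply pow_lt; lra).
  assert (Dd : 0 < Rabs d * 3 ^ n)
    by (apply Rmult_lt_0_compat; [apply Rabs_pos_lt; exact Hd|apply P]).
  destruct (pow_lt_1_zero (/ 3) ltac:(rewrite Rabs_pos_eq; lra) delta Hdelta)
    as (N1 & HN1).
  destruct (Pow_x_infinity _ Hb (Rabs C / (Rabs d * 3 ^ n) + 1)) as (N2 & HN2).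
  set (m := max N1 N2).
  specialize (HN1 (n + m)%nat ltac:(lia)).
  specialize (HN2 m ltac:(lia)).
  destruct (nested_cells a n k r m Hr Hk) as (j & J1 & J2 & J3).
  fold y in J2; fold d in J3.
  pose proof (P (n + m)%nat) as Pm.
  rewrite pow_inv, Rabs_pos_eq in HN1
    by (apply Rlt_le, Rinv_0_lt_compat, Pm).
  assert (Pi : 0 < / 3 ^ (n + m)) by (apply Rinv_0_lt_compat, Pm).
  assert (Hr2 : 0 <= INR r / 2 <= 1).
  { pose proof (pos_INR r); assert (INR r <= INR 2) by (apply le_INR; lia).
    simpl (INR 2) in *; lra. }
  assert (Hj : INR (S j) <= 3 ^ (n + m)).
  { replace 3 with (INR 3) by (simpl; ring).
    rewrite <- pow_INR; apply le_INR; lia. }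
  assert (Y : y = INR j / 3 ^ (n + m) + INR r / 2 * / 3 ^ (n + m))
    by (rewrite <- J2; unfold Rdiv; ring).
  assert (V : INR (S j) / 3 ^ (n + m) = INR j / 3 ^ (n + m) + / 3 ^ (n + m))
    by (rewrite S_INR; unfold Rdiv; ring).
  assert (U0 : 0 <= INR j / 3 ^ (n + m))
    by (apply Rmult_le_pos; [apply pos_INR|lra]).
  assert (V1 : INR (S j) / 3 ^ (n + m) <= 1) by (apply Rle_div_l; lra).
  specialize (B (INR j / 3 ^ (n + m)) (INR (S j) / 3 ^ (n + m))).
  rewrite !okamoto_at_node in B; fold (cell_increment a (n + m) j) in B.
  rewrite J3, V in B; rewrite V in V1; unfold unit_interval in B.
  specialize (B ltac:(lra) ltac:(lra) ltac:(nra) ltac:(nra) ltac:(nra)).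
  replace (INR j / 3 ^ (n + m) + / 3 ^ (n + m) - INR j / 3 ^ (n + m))
    with (/ 3 ^ (n + m)) in B by ring.
  fold (Rdiv C (3 ^ (n + m))) in B; apply Rle_div_r in B; [|exact Pm].
  assert (E : Rabs (child_ratio a r ^ m * d) * 3 ^ (n + m) =
              Rabs ((3 * child_ratio a r) ^ m) * (Rabs d * 3 ^ n)).
  { rewrite Rpow_mult_distr, !Rabs_mult, (Rabs_pos_eq (3 ^ m)), pow_add
      by (apply Rlt_le, P); ring. }
  rewrite E in B.
  apply Rge_le, (Rmult_le_compat_r (Rabs d * 3 ^ n)) in HN2; [|lra].
  replace ((Rabs C / (Rabs d * 3 ^ n) + 1) * (Rabs d * 3 ^ n))
    with (Rabs C + Rabs d * 3 ^ n) in HN2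
    by (field; split; [apply pow_nonzero; lra|apply Rabs_no_R0, Hd]).
  pose proof (Rle_abs C); lra.
Qed.

Lemma small_cell (x delta : R) : unit_interval x -> 0 < delta ->
  exists n k : nat, (k < 3 ^ n)%nat /\
    forall t, 0 <= t <= 1 -> unit_interval ((INR k + t) / 3 ^ n) /\
      Rabs ((INR k + t) / 3 ^ n - x) < delta.
Proof.
  intros [Hx0 Hx1] Hd.
  destruct (pow_lt_1_zero (/ 3) ltac:(rewrite Rabs_pos_eq; lra) delta Hd)
    as (n & Hn).
  specialize (Hn n ltac:(lia)).
  assert (P : 0 < 3 ^ n) by (apply pow_lt; lra).
  assert (Pi : 0 < / 3 ^ n) by (apply Rinv_0_lt_compat, P).
  rewrite pow_inv, Rabs_pos_eq in Hn by lra.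
  assert (E3 : INR (3 ^ n) = 3 ^ n)
    by (rewrite pow_INR; f_equal; simpl; ring).
  assert (K : exists k, (k < 3 ^ n)%nat /\ INR k <= 3 ^ n * x <= INR k + 1).
  { destruct (nat_cell (3 ^ n * x)) as (k & K1 & K2); [nra|].
    rewrite S_INR in K2.
    destruct (Nat.lt_ge_cases k (3 ^ n)) as [L|L].
    - exists k; split; [exact L|lra].
    (* Here [x = 1], which belongs to the last cell only as a right endpoint. *)
    - exists (3 ^ n - 1)%nat; apply le_INR in L.
      assert (0 < 3 ^ n)%nat by (apply INR_lt; rewrite E3; exact P).
      split; [lia|]; rewrite minus_INR, E3 by lia; simpl (INR 1); nra. }
  destruct K as (k & K1 & K2).
  exists n, k; split; [exact K1|]; intros t Ht.
  assert (Hk : INR k + 1 <= 3 ^ n)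
    by (rewrite <- E3, <- S_INR; apply le_INR; lia).
  pose proof (pos_INR k).
  split.
  - split; [apply Rle_div_r; lra|apply Rle_div_l; lra].
  - replace ((INR k + t) / 3 ^ n - x)
      with ((INR k + t - 3 ^ n * x) * / 3 ^ n) by (field; lra).
    rewrite Rabs_mult, (Rabs_pos_eq (/ 3 ^ n)) by lra.
    assert (Rabs (INR k + t - 3 ^ n * x) <= 1) by (apply Rabs_le; lra).
    nra.
Qed.

Lemma okamoto_no_second_derivative (a x : R) :
  0 < a -> a <> 1 / 3 -> a <> 1 / 2 -> unit_interval x ->
  ~ ex_second_derivative (okamoto a) x.
Proof.
  intros H0 H3 H2 Hx (f' & (delta & Hd & H) & _).
  assert (R : exists r, (r < 3)%nat /\ 1 < Rabs (3 * child_ratio a r)).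
  { destruct (Rlt_le_dec (1 / 3) a) as [L|L]; [exists 0%nat|exists 1%nat];
      split; try lia; simpl; rewrite Rabs_pos_eq; lra. }
  destruct R as (r & Hr & Hb).
  destruct (small_cell x delta Hx Hd) as (n & k & Hk & C).
  assert (Hr2 : 0 <= INR r / 2 <= 1).
  { pose proof (pos_INR r); assert (INR r <= INR 2) by (apply le_INR; lia).
    simpl (INR 2) in *; lra. }
  destruct (C _ Hr2) as [C1 C2].
  apply (okamoto_not_derivable a f' n k r Hr Hk); [|exact Hb|exact (H _ C1 C2)].
  apply cell_increment_neq_0; lra.
Qed.

(** * The threshold cubic *)

(** [54 * t ^ 3 - 27 * t ^ 2 - 1] is [-1] at [1/2], is [3] at [2/3] and
    increases in between. *)
Lemma threshold_unique :
  exists! a0 : R, 1 / 2 < a0 < 2 / 3 /\ 27 * a0 ^ 2 - 54 * a0 ^ 3 = -1.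
Proof.
  set (p := fun t => 54 * t ^ 3 - 27 * t ^ 2 - 1).
  assert (Cp : continuity p) by (unfold p; reg).
  destruct (IVT p (1 / 2) (2 / 3) Cp) as (z & Hz & Ez); unfold p in *; try lra.
  exists z; split.
  - split; [|lra].
    assert (z <> 1 / 2) by (intros ->; lra).
    assert (z <> 2 / 3) by (intros ->; lra); lra.
  - intros w [Hw Ew].
    assert (F : (w - z) * (54 * (w ^ 2 + w * z + z ^ 2) - 27 * (w + z)) = 0)
      by nra.
    apply Rmult_integral in F; destruct F as [F|F]; [lra|nra].
Qed.

Theorem theorem2 :
  (exists! a0 : R, 1 / 2 < a0 < 2 / 3 /\ 27 * a0 ^ 2 - 54 * a0 ^ 3 = -1) /\
  forall a0 : R,
    1 / 2 < a0 < 2 / 3 -> 27 * a0 ^ 2 - 54 * a0 ^ 3 = -1 ->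
    forall a : R,
      0 < a < 1 / 3 \/ 1 / 3 < a < 1 / 2 \/ 1 / 2 < a < a0 ->
      forall x : R, 0 <= x <= 1 -> ~ ex_second_derivative (okamoto a) x.
Proof.
  split; [exact threshold_unique|].
  intros a0 _ _ a Ha x Hx.
  apply okamoto_no_second_derivative; [lra|lra|lra|exact Hx].
Qed.
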